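(* Let $N$ and $H$ be monoids. There is an equivalence of categories between the category of Schreier extensions of monoids with kernel $N$ and cokernel $H$ and the category whose objects are normal lax monoidal functors from $H$ (viewed as a discrete monoidal category) to the monoidal category $\mathrm{End}_{\mathbf{Mon}^{\mathrm{co}}}(N)$ and whose morphisms are monoidal natural transformations.
   Context: Extensions. An extension of monoids with kernel $N$ and cokernel $H$ is a diagram $N \xrightarrow{k} G \xrightarrow{e} H$ of monoid homomorphisms in which $k$ is the kernel of $e$ (i.e. $k$ is injective with image $e^{-1}(1)$) and $e$ is the cokernel of $k$ in the category of monoids. It is Schreier if for every $h \in H$ there is a $u_h \in e^{-1}(h)$ such that for each $g \in e^{-1}(h)$ there is a unique $n \in N$ with $g = k(n)u_h$. A morphism from $N \xrightarrow{k} G \xrightarrow{e} H$ to $N \xrightarrow{k'} G' \xrightarrow{e'} H$ is a monoid homomorphism $t\colon G \to G'$ with $tk = k'$ and $e't = e$. The monoidal category. $\mathbf{Mon}$ is the 2-category of monoids (regarded as one-object categories), monoid homomorphisms (functors) and natural transformations; $\mathbf{Mon}^{\mathrm{co}}$ is obtained by reversing its 2-morphisms. Explicitly, $\mathrm{End}_{\mathbf{Mon}^{\mathrm{co}}}(N)$ is the strict monoidal category whose objects are the monoid endomorphisms of $N$; whose morphisms $f \to f'$ are the elements $m \in N$ such that $m f'(n) = f(n) m$ for all $n \in N$; where the composite of $m\colon f \to f'$ followed by $m'\colon f' \to f''$ is the product $m m'$, and the identities are given by $1 \in N$; the tensor product on objects is composition $f \otimes g = f\circ g$ with unit $I = \mathrm{id}_N$;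 and the tensor product of $m\colon f \to f'$ and $\ell\colon g \to g'$ is $m f'(\ell)\colon f\circ g \to f' \circ g'$. Monoidal functors. The monoid $H$ is viewed as a discrete monoidal category: its objects are the elements of $H$, its only morphisms are identities, and its tensor product is multiplication. A lax monoidal functor $L$ has a unit map $\iota^L\colon I \to L(1)$ and structure maps $\gamma^L_{x,y}\colon L(x) \otimes L(y) \to L(xy)$ satisfying the usual unit and associativity axioms; it is normal if its unit map $\iota^L$ is an identity morphism (in particular $L(1) = I$). A monoidal natural transformation $\tau\colon L_1 \to L_2$ is a natural transformation with $\tau_I\, \iota^{L_1} = \iota^{L_2}$ and $\tau_{x\otimes y}\,\gamma^{L_1}_{x,y} = \gamma^{L_2}_{x,y}(\tau_x \otimes \tau_y)$ for all objects $x,y$ of the domain (with $I$ in $\tau_I$ denoting the monoidal unit of the domain). *)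

(* Defs.v *)
From HB Require Import structures.
From mathcomp Require Import all_boot.
From mathcomp Require Import boolp.

Set Implicit Arguments.
Unset Strict Implicit.
Unset Printing Implicit Defensive.

Declare Scope cat_scope.
Delimit Scope cat_scope with cat.

Reserved Notation "g ∘ f" (at level 40, left associativity).
Reserved Notation "x ⊗ y" (at level 40, left associativity).
Reserved Notation "f ⊠ g" (at level 40, left associativity).

Record category := Category {
  obj :> Type;
  hom : obj -> obj -> Type;
  idm : forall x, hom x x;
  comp : forall x y z, hom y z -> hom x y -> hom x z;
  comp_id_l : forall x y (f : hom x y), comp (idm y) f = f;
  comp_id_r : forall x y (f : hom x y), comp f (idm x) = f;
  compA : forall x y z t (h : hom z t) (g : hom y z) (f : hom x y),
      comp h (comp g f) = comp (comp h g) f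
}.
Arguments hom {c} _ _.
Arguments idm {c} x.
Arguments comp {c x y z} _ _.

Notation "g ∘ f" := (comp g f) : cat_scope.
Local Open Scope cat_scope.

(* The family is indexed by the codomain: is_identity f entails that domain  *)
(* and codomain are equal and that f is the identity along that equality.   *)
Inductive is_identity (C : category) (x : C) : forall y : C, hom x y -> Prop :=
  IsIdentity : is_identity (idm x).

Definition is_iso (C : category) (x y : C) (f : hom x y) : Prop :=
  exists g : hom y x, g ∘ f = idm x /\ f ∘ g = idm y.

Record functor (C D : category) := Functor {
  fobj :> C -> D;
  fmap : forall x y, hom x y -> hom (fobj x) (fobj y);
  fmap_id : forall x, fmap (idm x) = idm (fobj x);
  fmap_comp : forall x y z (g : hom y z) (f : hom x y),
      fmap (g ∘ f) = fmap g ∘ fmap f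
}.
Arguments fmap {C D} F {x y} _ : rename.

Definition id_functor (C : category) : functor C C :=
  @Functor C C id (fun _ _ f => f) (fun _ => erefl) (fun _ _ _ _ _ => erefl).

Section CompFunctor.
Variables (C D E : category) (G : functor D E) (F : functor C D).

Lemma comp_functor_id x : fmap G (fmap F (idm x)) = idm (G (F x)).
Proof. by rewrite !fmap_id. Qed.

Lemma comp_functor_comp x y z (g : hom y z) (f : hom x y) :
  fmap G (fmap F (g ∘ f)) = fmap G (fmap F g) ∘ fmap G (fmap F f).
Proof. by rewrite !fmap_comp. Qed.

Definition comp_functor : functor C E :=
  @Functor C E (fun x => G (F x)) (fun _ _ f => fmap G (fmap F f))
    comp_functor_id comp_functor_comp.
End CompFunctor.

Record nat_trans (C D : category) (F G : functor C D) := NatTrans {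
  component :> forall x, hom (F x) (G x);
  naturality : forall x y (f : hom x y),
      component y ∘ fmap F f = fmap G f ∘ component x
}.

Definition nat_isomorphic (C D : category) (F G : functor C D) : Prop :=
  exists alpha : nat_trans F G, forall x, is_iso (alpha x).

Definition equivalent_categories (C D : category) : Prop :=
  exists (F : functor C D) (G : functor D C),
    nat_isomorphic (comp_functor G F) (id_functor C) /\
    nat_isomorphic (comp_functor F G) (id_functor D).

Definition full_subcategory (C : category) (P : C -> Prop) : category :=
  @Category {x : C | P x} (fun x y => hom (sval x) (sval y))
    (fun x => idm (sval x)) (fun _ _ _ g f => g ∘ f)
    (fun _ _ f => comp_id_l f) (fun _ _ f => comp_id_r f)
    (fun _ _ _ _ h g f => compA h g f).

Record monoidal_category := MonoidalCategory {
  mcat :> category;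
  tens : mcat -> mcat -> mcat;
  tensm : forall x x' y y' : mcat,
      hom x x' -> hom y y' -> hom (tens x y) (tens x' y');
  munit : mcat;
  assoc : forall x y z : mcat, hom (tens (tens x y) z) (tens x (tens y z));
  lunitor : forall x : mcat, hom (tens munit x) x;
  runitor : forall x : mcat, hom (tens x munit) x;
  tensm_id : forall x y : mcat, tensm (idm x) (idm y) = idm (tens x y);
  tensm_comp : forall (x x' x'' y y' y'' : mcat)
      (g : hom x' x'') (f : hom x x') (k : hom y' y'') (h : hom y y'),
      tensm (g ∘ f) (k ∘ h) = tensm g k ∘ tensm f h;
  assoc_iso : forall x y z, is_iso (assoc x y z);
  lunitor_iso : forall x, is_iso (lunitor x);
  runitor_iso : forall x, is_iso (runitor x);
  assoc_nat : forall (x x' y y' z z' : mcat)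
      (f : hom x x') (g : hom y y') (h : hom z z'),
      assoc x' y' z' ∘ tensm (tensm f g) h = tensm f (tensm g h) ∘ assoc x y z;
  lunitor_nat : forall (x x' : mcat) (f : hom x x'),
      lunitor x' ∘ tensm (idm munit) f = f ∘ lunitor x;
  runitor_nat : forall (x x' : mcat) (f : hom x x'),
      runitor x' ∘ tensm f (idm munit) = f ∘ runitor x;
  triangle : forall x y : mcat,
      tensm (idm x) (lunitor y) ∘ assoc x munit y = tensm (runitor x) (idm y);
  pentagon : forall x y z t : mcat,
      assoc x y (tens z t) ∘ assoc (tens x y) z t
      = tensm (idm x) (assoc y z t) ∘ assoc x (tens y z) t
        ∘ tensm (assoc x y z) (idm t)
}.
Arguments tens {m} _ _.
Arguments tensm {m x x' y y'} _ _.
Arguments munit {m}.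
Arguments assoc {m} x y z.
Arguments lunitor {m} x.
Arguments runitor {m} x.

Notation "x ⊗ y" := (tens x y) : cat_scope.
Notation "f ⊠ g" := (tensm f g) : cat_scope.

Definition strict (M : monoidal_category) : Prop :=
  [/\ forall x y z : M, is_identity (assoc x y z),
      forall x : M, is_identity (lunitor x)
    & forall x : M, is_identity (runitor x)].

Record lax_monoidal_functor (M M' : monoidal_category) := LaxMonoidalFunctor {
  lfun :> functor M M';
  lax_unit : hom munit (lfun munit);
  lax_mul : forall x y : M, hom (lfun x ⊗ lfun y) (lfun (x ⊗ y));
  lax_mul_nat : forall (x x' y y' : M) (f : hom x x') (g : hom y y'),
      lax_mul x' y' ∘ (fmap lfun f ⊠ fmap lfun g)
      = fmap lfun (f ⊠ g) ∘ lax_mul x y;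
  lax_assoc : forall x y z : M,
      fmap lfun (assoc x y z) ∘ lax_mul (x ⊗ y) z
        ∘ (lax_mul x y ⊠ idm (lfun z))
      = lax_mul x (y ⊗ z) ∘ (idm (lfun x) ⊠ lax_mul y z)
        ∘ assoc (lfun x) (lfun y) (lfun z);
  lax_lunit : forall x : M,
      fmap lfun (lunitor x) ∘ lax_mul munit x ∘ (lax_unit ⊠ idm (lfun x))
      = lunitor (lfun x);
  lax_runit : forall x : M,
      fmap lfun (runitor x) ∘ lax_mul x munit ∘ (idm (lfun x) ⊠ lax_unit)
      = runitor (lfun x)
}.
Arguments lax_unit {M M'} L : rename.
Arguments lax_mul {M M'} L x y : rename.

Definition normal (M M' : monoidal_category) (L : lax_monoidal_functor M M') :
  Prop := is_identity (lax_unit L).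

Record monoidal_nat_trans (M M' : monoidal_category)
    (L1 L2 : lax_monoidal_functor M M') := MonoidalNatTrans {
  mnt :> nat_trans L1 L2;
  mnt_unit : mnt munit ∘ lax_unit L1 = lax_unit L2;
  mnt_mul : forall x y : M,
      mnt (x ⊗ y) ∘ lax_mul L1 x y = lax_mul L2 x y ∘ (mnt x ⊠ mnt y)
}.

Section LaxMonoidalFunctors.
Variables M M' : monoidal_category.
Implicit Types L : lax_monoidal_functor M M'.

Lemma mnt_eq L1 L2 (s t : monoidal_nat_trans L1 L2) :
  (forall x, s x = t x) -> s = t.
Proof.
case: s t => [[s s_nat] s1 sM] [[t t_nat] t1 tM] /= st.
have {st} eq_st : s = t by apply: functional_extensionality_dep.
subst t; rewrite (Prop_irrelevance t_nat s_nat) in t1 tM *.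
by rewrite (Prop_irrelevance t1 s1) (Prop_irrelevance tM sM).
Qed.

Section Id.
Variable L : lax_monoidal_functor M M'.

Lemma nt_id_nat (x y : M) (f : hom x y) :
  idm (L y) ∘ fmap L f = fmap L f ∘ idm (L x).
Proof. by rewrite comp_id_l comp_id_r. Qed.

Lemma mnt_id_unit : idm (L munit) ∘ lax_unit L = lax_unit L.
Proof. exact: comp_id_l. Qed.

Lemma mnt_id_mul (x y : M) :
  idm (L (x ⊗ y)) ∘ lax_mul L x y = lax_mul L x y ∘ (idm (L x) ⊠ idm (L y)).
Proof. by rewrite tensm_id comp_id_l comp_id_r. Qed.

Definition mnt_id : monoidal_nat_trans L L :=
  @MonoidalNatTrans _ _ L L (NatTrans nt_id_nat) mnt_id_unit mnt_id_mul.
End Id.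

Section Comp.
Variables (L1 L2 L3 : lax_monoidal_functor M M').
Variables (t : monoidal_nat_trans L2 L3) (s : monoidal_nat_trans L1 L2).

Lemma nt_comp_nat (x y : M) (f : hom x y) :
  (t y ∘ s y) ∘ fmap L1 f = fmap L3 f ∘ (t x ∘ s x).
Proof. by rewrite -compA naturality !compA naturality. Qed.

Lemma mnt_comp_unit : (t munit ∘ s munit) ∘ lax_unit L1 = lax_unit L3.
Proof. by rewrite -compA !mnt_unit. Qed.

Lemma mnt_comp_mul (x y : M) :
  (t (x ⊗ y) ∘ s (x ⊗ y)) ∘ lax_mul L1 x y
  = lax_mul L3 x y ∘ ((t x ∘ s x) ⊠ (t y ∘ s y)).
Proof. by rewrite -compA mnt_mul compA mnt_mul -compA -tensm_comp. Qed.

Definition mnt_comp : monoidal_nat_trans L1 L3 :=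
  @MonoidalNatTrans _ _ L1 L3 (NatTrans nt_comp_nat) mnt_comp_unit mnt_comp_mul.
End Comp.

Lemma mnt_comp_id_l L1 L2 (t : monoidal_nat_trans L1 L2) :
  mnt_comp (mnt_id L2) t = t.
Proof. by apply: mnt_eq => x; apply: comp_id_l. Qed.

Lemma mnt_comp_id_r L1 L2 (t : monoidal_nat_trans L1 L2) :
  mnt_comp t (mnt_id L1) = t.
Proof. by apply: mnt_eq => x; apply: comp_id_r. Qed.

Lemma mnt_compA L1 L2 L3 L4 (u : monoidal_nat_trans L3 L4)
    (t : monoidal_nat_trans L2 L3) (s : monoidal_nat_trans L1 L2) :
  mnt_comp u (mnt_comp t s) = mnt_comp (mnt_comp u t) s.
Proof. by apply: mnt_eq => x; apply: compA. Qed.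

Definition lax_monoidal_functors : category :=
  @Category (lax_monoidal_functor M M') (@monoidal_nat_trans M M')
    mnt_id mnt_comp mnt_comp_id_l mnt_comp_id_r mnt_compA.

Definition normal_lax_monoidal_functors : category :=
  @full_subcategory lax_monoidal_functors (@normal M M').
End LaxMonoidalFunctors.

Local Open Scope group_scope.

Notation monoid_hom := UMagmaMorphism.type.

Definition monoid_id (N : monoidType) : monoid_hom N N := idfun.
Definition monoid_comp (N G H : monoidType)
  (f : monoid_hom G H) (g : monoid_hom N G) : monoid_hom N H := f \o g.

Lemma monoid_hom_eq (G H : monoidType) (f g : monoid_hom G H) : f =1 g -> f = g.
Proof.
case: f g => [f [[f1] [fM]]] [g [[g1] [gM]]] /= /funext eq_fg.
subst g; by rewrite (Prop_irrelevance g1 f1) (Prop_irrelevance gM fM).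
Qed.

(* The discrete monoidal category on a monoid: the only morphisms x -> y are *)
(* proofs of x = y, that is, identities.                                     *)
Section Discrete.
Variable H : monoidType.

Definition discrete_cat : category :=
  @Category H (fun x y => x = y) (fun x => erefl)
    (fun _ _ _ g f => etrans f g)
    (fun _ _ _ => Prop_irrelevance _ _)
    (fun _ _ _ => Prop_irrelevance _ _)
    (fun _ _ _ _ _ _ _ => Prop_irrelevance _ _).

Lemma discrete_thin (x y : discrete_cat) (f g : hom x y) : f = g.
Proof. exact: (@Prop_irrelevance (x = y :> H) f g). Qed.

Lemma discrete_is_iso (x y : discrete_cat) (f : hom x y) : is_iso f.
Proof. by exists (esym f); split; apply: discrete_thin. Qed.

Definition discrete : monoidal_category :=
  @MonoidalCategory discrete_cat (fun x y : H => x * y)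
    (fun x x' y y' (f : x = x') (g : y = y') => congr2 mul f g)
    (1 : H)
    (fun x y z => esym (mulgA x y z)) (@mul1g H) (@mulg1 H)
    (fun _ _ => discrete_thin _ _)
    (fun _ _ _ _ _ _ _ _ _ _ => discrete_thin _ _)
    (fun _ _ _ => discrete_is_iso _)
    (fun _ => discrete_is_iso _)
    (fun _ => discrete_is_iso _)
    (fun _ _ _ _ _ _ _ _ _ => discrete_thin _ _)
    (fun _ _ _ => discrete_thin _ _)
    (fun _ _ _ => discrete_thin _ _)
    (fun _ _ => discrete_thin _ _)
    (fun _ _ _ _ => discrete_thin _ _).
End Discrete.

(* End_{Mon^co}(N): the 2-morphisms of Mon are reversed, so a morphism       *)
(* f -> f' is a natural transformation from f' to f.                         *)
Section EndMonCo.
Variable N : monoidType.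
Implicit Types f g h : monoid_hom N N.

Definition end_hom f f' := {m : N | forall n, m * f' n = f n * m}.

Lemma end_hom_eq f f' (m m' : end_hom f f') : sval m = sval m' -> m = m'.
Proof. by case: m m' => [m p] [m' q] /= e; apply: eq_exist. Qed.

Lemma end_id_proof f n : 1 * f n = f n * 1.
Proof. by rewrite mul1g mulg1. Qed.

Definition end_id f : end_hom f f := exist _ 1 (end_id_proof f).

Lemma end_comp_proof f f' f'' (m' : end_hom f' f'') (m : end_hom f f') n :
  sval m * sval m' * f'' n = f n * (sval m * sval m').
Proof. by rewrite -mulgA (svalP m') mulgA (svalP m) mulgA. Qed.

Definition end_comp f f' f'' (m' : end_hom f' f'') (m : end_hom f f') :
  end_hom f f'' := exist _ (sval m * sval m') (end_comp_proof m' m).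

Lemma end_comp_id_l f f' (m : end_hom f f') : end_comp (end_id f') m = m.
Proof. by apply: end_hom_eq; apply: mulg1. Qed.

Lemma end_comp_id_r f f' (m : end_hom f f') : end_comp m (end_id f) = m.
Proof. by apply: end_hom_eq; apply: mul1g. Qed.

Lemma end_compA f f' f'' f''' (m'' : end_hom f'' f''') (m' : end_hom f' f'')
    (m : end_hom f f') :
  end_comp m'' (end_comp m' m) = end_comp (end_comp m'' m') m.
Proof. by apply: end_hom_eq; rewrite /= mulgA. Qed.

Definition end_cat : category :=
  @Category (monoid_hom N N) end_hom end_id end_comp
    end_comp_id_l end_comp_id_r end_compA.

Lemma end_tens_proof f f' g g' (m : end_hom f f') (l : end_hom g g') n :
  sval m * f' (sval l) * (monoid_comp f' g') n
  = (monoid_comp f g) n * (sval m * f' (sval l)).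
Proof.
by rewrite /= -mulgA -gmulfM (svalP l) gmulfM mulgA (svalP m) mulgA.
Qed.

Definition end_tens f f' g g' (m : end_hom f f') (l : end_hom g g') :
  end_hom (monoid_comp f g) (monoid_comp f' g') :=
  exist _ (sval m * f' (sval l)) (end_tens_proof m l).

(* In the strict monoidal category End_{Mon^co}(N) the associator and the    *)
(* unitors are the identities, given by 1; see EndMonCo_strict below.        *)
Definition end_assoc f g h :
  end_hom (monoid_comp (monoid_comp f g) h) (monoid_comp f (monoid_comp g h)) :=
  exist _ 1 (end_id_proof (monoid_comp f (monoid_comp g h))).

Definition end_lunitor f : end_hom (monoid_comp (monoid_id N) f) f :=
  exist _ 1 (end_id_proof f).

Definition end_runitor f : end_hom (monoid_comp f (monoid_id N)) f :=
  exist _ 1 (end_id_proof f).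

Lemma end_is_iso (f f' : end_cat) (m : hom f f') : sval m = 1 -> is_iso m.
Proof.
case: m => m /= mP m1; subst m.
have mP' n : 1 * f n = f' n * 1 by rewrite mul1g mulg1 -[f n]mulg1 -mP mul1g.
by exists (exist _ 1 mP'); split; apply: end_hom_eq; rewrite /= mulg1.
Qed.

Lemma end_tens_id f g : end_tens (end_id f) (end_id g) = end_id (monoid_comp f g).
Proof. by apply: end_hom_eq; rewrite /= gmulf1 mulg1. Qed.

Lemma end_tens_comp f f' f'' g g' g'' (m' : end_hom f' f'') (m : end_hom f f')
    (l' : end_hom g' g'') (l : end_hom g g') :
  end_tens (end_comp m' m) (end_comp l' l)
  = end_comp (end_tens m' l') (end_tens m l).
Proof.
apply: end_hom_eq; rewrite /= gmulfM !mulgA; congr (_ * _).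
by rewrite -!mulgA (svalP m').
Qed.

Lemma end_assoc_nat f f' g g' h h' (m : end_hom f f') (l : end_hom g g')
    (p : end_hom h h') :
  end_comp (end_assoc f' g' h') (end_tens (end_tens m l) p)
  = end_comp (end_tens m (end_tens l p)) (end_assoc f g h).
Proof. by apply: end_hom_eq; rewrite /= mulg1 mul1g gmulfM mulgA. Qed.

Lemma end_lunitor_nat f f' (m : end_hom f f') :
  end_comp (end_lunitor f') (end_tens (end_id (monoid_id N)) m)
  = end_comp m (end_lunitor f).
Proof. by apply: end_hom_eq; rewrite /= mulg1. Qed.

Lemma end_runitor_nat f f' (m : end_hom f f') :
  end_comp (end_runitor f') (end_tens m (end_id (monoid_id N)))
  = end_comp m (end_runitor f).
Proof. by apply: end_hom_eq; rewrite /= gmulf1 !mulg1 mul1g. Qed.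

Lemma end_triangle f g :
  end_comp (end_tens (end_id f) (end_lunitor g)) (end_assoc f (monoid_id N) g)
  = end_tens (end_runitor f) (end_id g).
Proof. by apply: end_hom_eq; rewrite /= !gmulf1 !mulg1. Qed.

Lemma end_pentagon f g h k :
  end_comp (end_assoc f g (monoid_comp h k)) (end_assoc (monoid_comp f g) h k)
  = end_comp (end_comp (end_tens (end_id f) (end_assoc g h k))
                       (end_assoc f (monoid_comp g h) k))
             (end_tens (end_assoc f g h) (end_id k)).
Proof. by apply: end_hom_eq; rewrite /= !gmulf1 !mulg1. Qed.

Definition EndMonCo : monoidal_category :=
  @MonoidalCategory end_cat (@monoid_comp N N N) end_tens (monoid_id N)
    end_assoc end_lunitor end_runitor end_tens_id end_tens_comp
    (fun f g h => end_is_iso (erefl : sval (end_assoc f g h) = 1))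
    (fun f => end_is_iso (erefl : sval (end_lunitor f) = 1))
    (fun f => end_is_iso (erefl : sval (end_runitor f) = 1))
    end_assoc_nat end_lunitor_nat end_runitor_nat end_triangle end_pentagon.

Lemma end_is_identity (f f' : EndMonCo) (m : hom f f') :
  f = f' -> sval m = 1 -> is_identity m.
Proof.
move=> ff'; subst f' => m1.
by have -> : m = idm f by apply: end_hom_eq.
Qed.

Lemma EndMonCo_strict : strict EndMonCo.
Proof.
by split=> *; apply: end_is_identity => //; apply: monoid_hom_eq.
Qed.
End EndMonCo.

Definition is_kernel (N G H : monoidType) (k : monoid_hom N G)
    (e : monoid_hom G H) : Prop :=
  injective k /\ forall g, e g = 1 <-> exists n, k n = g.

Definition is_cokernel (N G H : monoidType) (k : monoid_hom N G)
    (e : monoid_hom G H) : Prop :=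
  (forall n, e (k n) = 1) /\
  forall (X : monoidType) (f : monoid_hom G X), (forall n, f (k n) = 1) ->
    exists! f' : monoid_hom H X, monoid_comp f' e = f.

Section Extensions.
Variables N H : monoidType.

Record extension := Extension {
  ext_mid : monoidType;
  ext_k : monoid_hom N ext_mid;
  ext_e : monoid_hom ext_mid H;
  ext_kernel : is_kernel ext_k ext_e;
  ext_cokernel : is_cokernel ext_k ext_e
}.

Definition schreier (E : extension) : Prop :=
  forall h : H, exists2 u : ext_mid E, ext_e E u = h &
    forall g, ext_e E g = h -> exists! n : N, g = ext_k E n * u.

Record extension_hom (E E' : extension) := ExtensionHom {
  ext_map :> monoid_hom (ext_mid E) (ext_mid E');
  ext_map_k : monoid_comp ext_map (ext_k E) = ext_k E';
  ext_map_e : monoid_comp (ext_e E') ext_map = ext_e E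
}.

Lemma extension_hom_eq E E' (s t : extension_hom E E') :
  (s =1 t) -> s = t.
Proof.
case: s t => [s sk se] [t tk te] /= /monoid_hom_eq st; subst t.
by rewrite (Prop_irrelevance tk sk) (Prop_irrelevance te se).
Qed.

Lemma ext_id_k E :
  monoid_comp (monoid_id (ext_mid E)) (ext_k E) = ext_k E.
Proof. exact: monoid_hom_eq. Qed.

Lemma ext_id_e E :
  monoid_comp (ext_e E) (monoid_id (ext_mid E)) = ext_e E.
Proof. exact: monoid_hom_eq. Qed.

Definition ext_id E : extension_hom E E :=
  ExtensionHom (ext_id_k E) (ext_id_e E).

Section Comp.
Variables (E E' E'' : extension).
Variables (t : extension_hom E' E'') (s : extension_hom E E').

Lemma ext_comp_k : monoid_comp (monoid_comp t s) (ext_k E) = ext_k E''.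
Proof.
by rewrite -(ext_map_k t) -(ext_map_k s); apply: monoid_hom_eq.
Qed.

Lemma ext_comp_e : monoid_comp (ext_e E'') (monoid_comp t s) = ext_e E.
Proof.
by rewrite -(ext_map_e s) -(ext_map_e t); apply: monoid_hom_eq.
Qed.

Definition ext_comp : extension_hom E E'' := ExtensionHom ext_comp_k ext_comp_e.
End Comp.

Lemma ext_comp_id_l E E' (t : extension_hom E E') : ext_comp (ext_id E') t = t.
Proof. exact: extension_hom_eq. Qed.

Lemma ext_comp_id_r E E' (t : extension_hom E E') : ext_comp t (ext_id E) = t.
Proof. exact: extension_hom_eq. Qed.

Lemma ext_compA E1 E2 E3 E4 (u : extension_hom E3 E4) (t : extension_hom E2 E3)
    (s : extension_hom E1 E2) :
  ext_comp u (ext_comp t s) = ext_comp (ext_comp u t) s.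
Proof. exact: extension_hom_eq. Qed.

Definition extensions : category :=
  @Category extension extension_hom ext_id ext_comp
    ext_comp_id_l ext_comp_id_r ext_compA.

Definition schreier_extensions : category :=
  @full_subcategory extensions schreier.
End Extensions.

(* Main.v *)
(** A normal lax monoidal functor [L] amounts to endomorphisms [phi_x] of [N]
    and elements [gamma_{x,y}] satisfying a cocycle identity; lax associativity
    and unitality are exactly what makes [N * H] a monoid under
    [(n, x) (m, y) = (n phi_x(m) gamma_{x,y}, x y)].  A monoidal transformation
    [tau] acts by [(n, x) |-> (n tau_x, x)], and every morphism of such
    extensions has this form because it fixes [N] and preserves fibres.  This
    crossed product functor is thus fully faithful.  It is essentially
    surjective: a Schreier extension with representatives [u_x], normalized so
    that [u_1 = 1], is the crossed product for
    [u_x k(n) = k(phi_x n) u_x] and [u_x u_y = k(gamma_{x,y}) u_{x y}]. *)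

From HB Require Import structures.
From mathcomp Require Import all_boot.
From mathcomp Require Import boolp.
Require Import Defs.

Set Implicit Arguments.
Unset Strict Implicit.
Unset Printing Implicit Defensive.

Local Open Scope cat_scope.
Local Open Scope group_scope.

(** * Fully faithful, essentially surjective functors are equivalences *)

Lemma fully_faithful_essentially_surjective_equivalence
    (C D : category) (F : functor C D) :
  (forall (x y : C) (f g : hom x y), fmap F f = fmap F g -> f = g) ->
  (forall (x y : C) (g : hom (F x) (F y)), exists f : hom x y, fmap F f = g) ->
  (forall d : D, exists c : C, exists f : hom (F c) d, is_iso f) ->
  equivalent_categories D C.
Proof.
move=> faithful full /choice[G0 esurj].
pose lift x y (g : hom (F x) (F y)) : hom x y := sval (cid (full x y g)).
have liftK x y (g : hom (F x) (F y)) : fmap F (lift x y g) = g.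
  exact: (svalP (cid (full x y g))).
pose eps d : hom (F (G0 d)) d := sval (cid (esurj d)).
have eps_iso d : is_iso (eps d) by exact: (svalP (cid (esurj d))).
pose eta d := sval (cid (eps_iso d)).
have epsK d : eta d ∘ eps d = idm _ by exact: (svalP (cid (eps_iso d))).1.
have etaK d : eps d ∘ eta d = idm _ by exact: (svalP (cid (eps_iso d))).2.
(* Conjugate by the chosen isomorphisms [eps], then pull back along [F]; faithfulness lets every law
   of [G] be checked after applying [F]. *)
pose G1 d d' (f : hom d d') := lift _ _ (eta d' ∘ f ∘ eps d).
have G1_id d : G1 d d (idm d) = idm (G0 d).
  by apply: faithful; rewrite liftK comp_id_r fmap_id epsK.
have G1_comp x y z (g : hom y z) (f : hom x y) :
    G1 x z (g ∘ f) = G1 y z g ∘ G1 x y f.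
  apply: faithful; rewrite fmap_comp !liftK.
  by rewrite -!compA [eps y ∘ _]compA etaK comp_id_l.
pose G : functor D C := Functor G1_id G1_comp.
exists G, F; split.
  have eps_nat x y (f : hom x y) :
      eps y ∘ fmap (comp_functor F G) f = fmap (id_functor D) f ∘ eps x.
    by rewrite /= liftK !compA etaK comp_id_l.
  exists (@NatTrans _ _ (comp_functor F G) (id_functor D) eps eps_nat) => d.
  by exists (eta d); split; [apply: epsK | apply: etaK].
(* The second natural isomorphism and its inverse are lifts of [eps (F c)] and [eta (F c)]. *)
pose theta c : hom (G (F c)) c := lift (G0 (F c)) c (eps (F c)).
have theta_nat x y (f : hom x y) :
    theta y ∘ fmap (comp_functor G F) f = fmap (id_functor C) f ∘ theta x.
  apply: faithful; rewrite !fmap_comp /= !liftK.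
  by rewrite !compA etaK comp_id_l.
exists (@NatTrans _ _ (comp_functor G F) (id_functor C) theta theta_nat).
move=> c; exists (lift c (G0 (F c)) (eta (F c))).
by split; apply: faithful; rewrite fmap_comp !liftK fmap_id (epsK, etaK).
Qed.

Definition make_monoid_hom (G H : monoidType) (f : G -> H)
    (f1 : f 1 = 1) (fM : {morph f : x y / x * y}) : monoid_hom G H :=
  HB.pack f (isUMagmaMorphism.Build G H f (f1, fM)).

(** * Action and cocycle underlying a lax monoidal functor *)

Section ActionCocycle.
Variables N H : monoidType.
Implicit Type L : lax_monoidal_functor (discrete H) (EndMonCo N).

Definition lax_act L (x : H) : monoid_hom N N := L x.
Definition lax_coc L (x y : H) : N := sval (lax_mul L x y).

Lemma lax_cocJ L x y n :
  lax_coc L x y * lax_act L (x * y) n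
  = lax_act L x (lax_act L y n) * lax_coc L x y.
Proof. exact: (svalP (lax_mul L x y)). Qed.

Lemma lax_fmap_discrete L (x y : discrete H) (p : hom x y) :
  sval (fmap L p : end_hom (L x) (L y)) = 1.
Proof. by case: y / p; rewrite (fmap_id L). Qed.

(** Underlying elements multiply in diagrammatic order, and the associators and the images of
    discrete morphisms are 1, so only the cocycle terms of [lax_assoc] survive. *)
Lemma lax_coc_assoc L x y z :
  lax_coc L x y * lax_coc L (x * y) z
  = lax_act L x (lax_coc L y z) * lax_coc L x (y * z).
Proof.
have /(congr1 sval) := lax_assoc L x y z.
by rewrite /= lax_fmap_discrete gmulf1 !mulg1 !mul1g.
Qed.

(** Inversion of [is_identity]; passing to [sval m] avoids an equation between morphisms of
    different types. *)
Lemma end_identityP (f g : monoid_hom N N) (m : end_hom f g) :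
  @is_identity (EndMonCo N) f g m -> f = g /\ sval m = 1.
Proof. by case. Qed.

Lemma normal_act1 L : normal L -> lax_act L 1 =1 id.
Proof. by move=> /end_identityP[L1 _] n; rewrite /lax_act -L1. Qed.

Lemma normal_coc1l L x : normal L -> lax_coc L 1 x = 1.
Proof.
move=> /end_identityP[_ iota1]; have /(congr1 sval) := lax_lunit L x.
by rewrite /= iota1 lax_fmap_discrete gmulf1 !mulg1 !mul1g.
Qed.

Lemma normal_coc1r L x : normal L -> lax_coc L x 1 = 1.
Proof.
move=> /end_identityP[_ iota1]; have /(congr1 sval) := lax_runit L x.
by rewrite /= iota1 lax_fmap_discrete gmulf1 !mulg1 !mul1g.
Qed.

End ActionCocycle.

(** * The crossed product extension *)

Definition crossed_product (N H : monoidType)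
    (_ : normal_lax_monoidal_functors (discrete H) (EndMonCo N)) : Type :=
  (N * H)%type.

Section CrossedProduct.
Variables N H : monoidType.
Variable L : normal_lax_monoidal_functors (discrete H) (EndMonCo N).

Let phi := lax_act (sval L).
Let gamma := lax_coc (sval L).

(** Only the choice structure is copied: the name [crossed_product L] keeps the twisted
    multiplication below apart from the direct product on [N * H]. *)
HB.instance Definition _ := Choice.copy (crossed_product L) (N * H)%type.

Definition cp_mul (a b : crossed_product L) : (crossed_product L) :=
  (a.1 * phi a.2 b.1 * gamma a.2 b.2, a.2 * b.2).

Lemma cp_mulA : associative cp_mul.
Proof.
move=> [n x] [m y] [p z]; congr (_, _) => /=; last exact: mulgA.
(* With [n] and [phi x m] cancelled, the cocycle identity produces [gamma x y], and [lax_cocJ] moves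
   it past the action on [p]. *)
rewrite !gmulfM -!mulgA; do 2!congr (_ * _).
by rewrite -lax_coc_assoc [in RHS]mulgA lax_cocJ mulgA.
Qed.

Lemma cp_mul1g : left_id ((1, 1) : crossed_product L) cp_mul.
Proof.
move=> [n x]; rewrite /cp_mul /= /phi /gamma.
by rewrite (normal_act1 (svalP L)) (normal_coc1l _ (svalP L)) !mul1g mulg1.
Qed.

Lemma cp_mulg1 : right_id ((1, 1) : crossed_product L) cp_mul.
Proof.
move=> [n x]; rewrite /cp_mul /= /phi /gamma.
by rewrite gmulf1 (normal_coc1r _ (svalP L)) !mulg1.
Qed.

HB.instance Definition _ :=
  isMonoid.Build (crossed_product L) cp_mulA cp_mul1g cp_mulg1.

Lemma cp_mulE (a b : crossed_product L) :
  a * b = (a.1 * phi a.2 b.1 * gamma a.2 b.2, a.2 * b.2) :> crossed_product L.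
Proof. by []. Qed.

Definition cp_in (n : N) : (crossed_product L) := (n, 1).
Definition cp_out (a : crossed_product L) : H := a.2.

Lemma cp_inM : {morph cp_in : n m / n * m}.
Proof.
move=> n m; rewrite cp_mulE /= /phi /gamma.
by rewrite (normal_act1 (svalP L)) (normal_coc1l _ (svalP L)) !mulg1.
Qed.

Definition cp_k : monoid_hom N (crossed_product L) :=
  make_monoid_hom (erefl : cp_in 1 = 1) cp_inM.

Definition cp_e : monoid_hom (crossed_product L) H :=
  make_monoid_hom (erefl : cp_out 1 = 1)
    (fun _ _ => erefl : cp_out (_ * _) = cp_out _ * cp_out _).

(** The elements [(1, x)] are the Schreier representatives; the cokernel property and fullness also
    rest on this factorization. *)
Lemma cp_decomp n x : (n, x) = cp_k n * ((1, x) : crossed_product L).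
Proof.
rewrite cp_mulE /= /phi /gamma.
by rewrite gmulf1 (normal_coc1l _ (svalP L)) !mulg1 mul1g.
Qed.

Lemma cp_kernel : is_kernel cp_k cp_e.
Proof.
split=> [n m [] // | [n x]]; split=> /= [x1 | [m [_ <-]] //].
by exists n; congr (_, _); apply: esym x1.
Qed.

(** By [cp_decomp], a homomorphism that kills the kernel ignores the first coordinate. It therefore
    ignores the [gamma x y] in [(1, x) * (1, y)], which makes [f'] multiplicative; uniqueness holds
    because [(1, x)] lies over [x]. *)
Lemma cp_cokernel : is_cokernel cp_k cp_e.
Proof.
split=> // X f fk; pose f' (x : H) := f ((1, x) : crossed_product L).
have fE n x : f (n, x) = f' x by rewrite cp_decomp gmulfM fk mul1g.
have f'1 : f' 1 = 1 by apply: gmulf1.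
have f'M : {morph f' : x y / x * y} by move=> x y; rewrite -gmulfM cp_mulE fE.
exists (make_monoid_hom f'1 f'M); split.
  by apply: monoid_hom_eq => -[n x] /=; rewrite fE.
move=> g gE; apply: monoid_hom_eq => x.
by rewrite /= /f' -gE.
Qed.

Definition cp_extension : extension N H := Extension cp_kernel cp_cokernel.

Lemma cp_schreier : schreier cp_extension.
Proof.
move=> x; exists (1, x) => // -[n y] /= <-; exists n; split.
  exact: cp_decomp.
by move=> m; rewrite -cp_decomp => -[].
Qed.

Definition schreier_cp : schreier_extensions N H :=
  exist _ cp_extension cp_schreier.

End CrossedProduct.

(** * The crossed product as a fully faithful functor *)

Section CrossedProductFunctor.
Variables N H : monoidType.
Let Lax := normal_lax_monoidal_functors (discrete H) (EndMonCo N).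

Definition mnt_val (L1 L2 : Lax) (t : hom L1 L2) (x : H) : N :=
  sval ((t : monoidal_nat_trans _ _) x).

Lemma mnt_valJ (L1 L2 : Lax) (t : hom L1 L2) x n :
  mnt_val t x * lax_act (sval L2) x n = lax_act (sval L1) x n * mnt_val t x.
Proof. exact: (svalP ((t : monoidal_nat_trans _ _) x)). Qed.

Lemma mnt_val1 (L1 L2 : Lax) (t : hom L1 L2) : mnt_val t 1 = 1.
Proof.
have /(congr1 sval) /= := mnt_unit (t : monoidal_nat_trans _ _).
have [_ ->] := end_identityP (svalP L1).
by have [_ ->] := end_identityP (svalP L2); rewrite mul1g.
Qed.

Lemma mnt_valM (L1 L2 : Lax) (t : hom L1 L2) x y :
  lax_coc (sval L1) x y * mnt_val t (x * y)
  = mnt_val t x * lax_act (sval L2) x (mnt_val t y) * lax_coc (sval L2) x y.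
Proof.
by have /(congr1 sval) := mnt_mul (t : monoidal_nat_trans _ _) x y.
Qed.

Section Map.
Variables (L1 L2 : Lax) (t : hom L1 L2).

Definition cp_map_fun (a : crossed_product L1) : crossed_product L2 :=
  (a.1 * mnt_val t a.2, a.2).

Lemma cp_map_fun1 : cp_map_fun 1 = 1.
Proof. by rewrite /cp_map_fun /= mnt_val1 mulg1. Qed.

(** Compatibility with the cocycles ([mnt_valM]) splits the component at [x * y]; [mnt_valJ] then
    exchanges the action of [L1] for that of [L2]. *)
Lemma cp_map_funM : {morph cp_map_fun : a b / a * b}.
Proof.
move=> [n x] [m y]; rewrite /cp_map_fun !cp_mulE /=; congr (_, _).
rewrite -!mulgA mnt_valM gmulfM; congr (_ * _).
by rewrite !mulgA mnt_valJ.
Qed.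

Definition cp_map := make_monoid_hom cp_map_fun1 cp_map_funM.

Lemma cp_map_k : monoid_comp cp_map (cp_k L1) = cp_k L2.
Proof.
by apply: monoid_hom_eq => n; rewrite /= /cp_map_fun /= mnt_val1 mulg1.
Qed.

Lemma cp_map_e : monoid_comp (cp_e L2) cp_map = cp_e L1.
Proof. exact: monoid_hom_eq. Qed.

Definition cp_hom : extension_hom (cp_extension L1) (cp_extension L2) :=
  @ExtensionHom N H (cp_extension L1) (cp_extension L2) cp_map cp_map_k cp_map_e.

End Map.

Lemma cp_hom_id (L : Lax) : cp_hom (idm L) = ext_id (cp_extension L).
Proof. by apply: extension_hom_eq => -[n x]; congr (_, _); apply: mulg1. Qed.

Lemma cp_hom_comp (L1 L2 L3 : Lax) (t : hom L2 L3) (s : hom L1 L2) :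
  cp_hom (t ∘ s) = ext_comp (cp_hom t) (cp_hom s).
Proof. by apply: extension_hom_eq => -[n x]; congr (_, _); apply: mulgA. Qed.

Definition cp_functor : functor Lax (schreier_extensions N H) :=
  @Functor Lax (schreier_extensions N H) (@schreier_cp N H) cp_hom
    cp_hom_id cp_hom_comp.

(** The component at [x] is recovered as the first coordinate of the image of [(1, x)]. *)
Lemma cp_functor_faithful (L1 L2 : Lax) (s t : hom L1 L2) :
  fmap cp_functor s = fmap cp_functor t -> s = t.
Proof.
move=> st; apply: mnt_eq => x; apply: end_hom_eq.
pose coord (r : extension_hom (cp_extension L1) (cp_extension L2)) : N :=
  (r ((1, x) : crossed_product L1) : crossed_product L2).1.
by have := congr1 coord st; rewrite /coord /= !mul1g.
Qed.

Lemma cp_functor_full (L1 L2 : Lax) (t : hom (cp_functor L1) (cp_functor L2)) :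
  exists s : hom L1 L2, fmap cp_functor s = t.
Proof.
pose r : crossed_product L1 -> crossed_product L2 := t.
have rk n : r (cp_k L1 n) = cp_k L2 n.
  exact: (congr1 (fun f : monoid_hom _ _ => f n) (ext_map_k t)).
have re a : (r a).2 = a.2.
  exact: (congr1 (fun f : monoid_hom _ _ => f a) (ext_map_e t)).
have rM a b : r (a * b) = r a * r b by apply: gmulfM.
(* Since [r] preserves fibres, it sends [(1, x)] to an element over [x], whose coordinate in [N] is
   the desired component. *)
pose tau x := (r (1, x)).1.
have r1 x : r (1, x) = (tau x, x).
  by rewrite [LHS]surjective_pairing re.
have rE n x : r (n, x) = (n * tau x, x).
  rewrite (cp_decomp L1) rM rk r1 cp_mulE /=.
  by rewrite (normal_act1 (svalP L2)) (normal_coc1l _ (svalP L2)) mulg1 mul1g.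
have tauJ x n :
    tau x * lax_act (sval L2) x n = lax_act (sval L1) x n * tau x.
  (* Multiplying a representative by a kernel element shows that [tau x] is a morphism of
     endomorphisms. *)
  have /(congr1 fst) := rM (1, x) (cp_k L1 n).
  rewrite rk r1 !cp_mulE rE /= !mul1g mulg1.
  by rewrite (normal_coc1r _ (svalP L1)) (normal_coc1r _ (svalP L2)) !mulg1.
have tauM x y : lax_coc (sval L1) x y * tau (x * y)
    = tau x * lax_act (sval L2) x (tau y) * lax_coc (sval L2) x y.
  (* Multiplying two representatives gives compatibility with the tensor product. *)
  have /(congr1 fst) := rM (1, x) (1, y).
  by rewrite !r1 !cp_mulE rE /= gmulf1 !mul1g.
have tau1 : tau 1 = 1 by rewrite /tau (rk 1).
pose sigma (x : discrete H) : hom (sval L1 x) (sval L2 x) :=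
  exist _ (tau x) (tauJ x).
have sigma_nat (x y : discrete H) (p : hom x y) :
    sigma y ∘ fmap (sval L1) p = fmap (sval L2) p ∘ sigma x.
  by apply: end_hom_eq; rewrite /= !lax_fmap_discrete mulg1 mul1g; case: y / p.
have sigma_unit : sigma munit ∘ lax_unit (sval L1) = lax_unit (sval L2).
  apply: end_hom_eq => /=; rewrite tau1.
  have [_ ->] := end_identityP (svalP L1).
  by have [_ ->] := end_identityP (svalP L2); rewrite mul1g.
have sigma_mul (x y : discrete H) : sigma (x ⊗ y) ∘ lax_mul (sval L1) x y
    = lax_mul (sval L2) x y ∘ (sigma x ⊠ sigma y).
  by apply: end_hom_eq; apply: tauM.
exists (@MonoidalNatTrans _ _ (sval L1) (sval L2) (NatTrans sigma_nat)
          sigma_unit sigma_mul).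
by apply: extension_hom_eq => -[n x]; rewrite -[RHS]/(r (n, x)) rE.
Qed.

End CrossedProductFunctor.

(** * Isomorphisms of extensions and normalized sections *)

Lemma extension_bijective_iso (N H : monoidType) (E E' : extension N H)
    (t : extension_hom E E') :
  bijective t -> @is_iso (extensions N H) E E' t.
Proof.
move=> [s tK sK].
have s1 : s 1 = 1 by apply: (canLR tK); rewrite gmulf1.
have sM : {morph s : x y / x * y}.
  by move=> x y; rewrite -{1}[x]sK -{1}[y]sK -gmulfM tK.
pose s' := make_monoid_hom s1 sM.
have s'k : monoid_comp s' (ext_k E') = ext_k E.
  by apply: monoid_hom_eq => n; rewrite -(ext_map_k t) /= tK.
have s'e : monoid_comp (ext_e E) s' = ext_e E'.
  by apply: monoid_hom_eq => g; rewrite -(ext_map_e t) /= sK.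
by exists (ExtensionHom s'k s'e); split; apply: extension_hom_eq.
Qed.

(** The unique existence in the Schreier condition is split into a coordinate function (existence)
    and right cancellation of each representative (uniqueness). *)
Record normal_section (N H : monoidType) (E : extension N H) := NormalSection {
  sec : H -> ext_mid E;
  sec_coord : ext_mid E -> N;
  sec1 : sec 1 = 1;
  sec_e : forall h, ext_e E (sec h) = h;
  sec_coordP : forall g, g = ext_k E (sec_coord g) * sec (ext_e E g);
  sec_inj : forall h, injective (fun n => ext_k E n * sec h)
}.

Lemma ext_e_k (N H : monoidType) (E : extension N H) n : ext_e E (ext_k E n) = 1.
Proof. by have [] := ext_cokernel E. Qed.

(* The representative of 1 given by the Schreier condition is some k(a), and  *)
(* 1 itself also qualifies, because k is the kernel of e.                     *)
Lemma schreier_normal_section (N H : monoidType) (E : extension N H) :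
  schreier E -> inhabited (normal_section E).
Proof.
move=> schE.
have reprs h : exists u : ext_mid E, [/\ ext_e E u = h, h = 1 -> u = 1 &
    forall g, ext_e E g = h -> exists! n : N, g = ext_k E n * u].
  have [h1 | /eqP hN1] := eqVneq h 1; last first.
    by have [u uh uP] := schE h; exists u.
  exists 1; split; rewrite ?h1 ?gmulf1 // => g.
  have [k_inj kP] := ext_kernel E; move=> /kP[n <-].
  by exists n; split=> [|m]; rewrite mulg1 // => /k_inj.
have [u /all_and3[ue u1 uP]] := choice reprs.
(* Each [g] gets its coordinate relative to the representative of its own fibre. *)
have [d dP] := choice (fun g => uP (ext_e E g) g erefl).
split; apply: (@NormalSection N H E u d) => //.
- exact: u1.
- by move=> g; have [] := dP g.
- move=> h n m eq_nm.
  have eh p : ext_e E (ext_k E p * u h) = h by rewrite gmulfM ext_e_k mul1g ue.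
  have [q [_ q_uniq]] := uP _ _ (eh n).
  by rewrite -(q_uniq n) // -(q_uniq m).
Qed.

(** * Reconstruction of the lax functor from a normalized section *)

Section ReconstructLax.
Variables (N H : monoidType) (E : extension N H) (S : normal_section E).

Let G := ext_mid E.
Let k : monoid_hom N G := ext_k E.
Let e : monoid_hom G H := ext_e E.
Let u : H -> G := sec S.
Let d : G -> N := sec_coord S.

Lemma sec_coordE h g : e g = h -> g = k (d g) * u h.
Proof. by move=> <-; apply: sec_coordP. Qed.

Lemma sec_coord_k n h : d (k n * u h) = n.
Proof.
apply: (@sec_inj _ _ _ S h); rewrite /= -/k -/u -sec_coordE //.
by rewrite gmulfM ext_e_k sec_e mul1g.
Qed.

Definition sec_act_fun h n := d (u h * k n).

Lemma sec_actE h n : u h * k n = k (sec_act_fun h n) * u h.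
Proof. by apply: sec_coordE; rewrite gmulfM ext_e_k sec_e mulg1. Qed.

(** As for the other laws of the action and cocycle, the identity in [N] is transported to [G] by
    the injection sending [n] to [k n * u h]. *)
Lemma sec_act_fun1 h : sec_act_fun h 1 = 1.
Proof.
by apply: (@sec_inj _ _ _ S h); rewrite /= -/k -/u -sec_actE !gmulf1 mulg1 mul1g.
Qed.

Lemma sec_act_funM h : {morph sec_act_fun h : n m / n * m}.
Proof.
move=> n m; apply: (@sec_inj _ _ _ S h); rewrite /= -/k -/u.
by rewrite -sec_actE !gmulfM mulgA sec_actE -!mulgA sec_actE.
Qed.

Definition sec_act h : monoid_hom N N :=
  make_monoid_hom (sec_act_fun1 h) (sec_act_funM h).

Definition sec_coc x y : N := d (u x * u y).

Lemma sec_cocE x y : u x * u y = k (sec_coc x y) * u (x * y).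
Proof. by apply: sec_coordE; rewrite gmulfM !sec_e. Qed.

(** Both sides are the coordinate of [u x * u y * k n] over [x * y]. *)
Lemma sec_cocJ x y n :
  sec_coc x y * sec_act (x * y) n = sec_act x (sec_act y n) * sec_coc x y.
Proof.
apply: (@sec_inj _ _ _ S (x * y)); rewrite /= -/k -/u !gmulfM -!mulgA.
by rewrite -sec_actE -sec_cocE mulgA -sec_cocE -mulgA sec_actE mulgA sec_actE mulgA.
Qed.

(** Both sides are the coordinate of [u x * u y * u z], bracketed in the two ways. *)
Lemma sec_coc_assoc x y z :
  sec_coc x y * sec_coc (x * y) z = sec_act x (sec_coc y z) * sec_coc x (y * z).
Proof.
apply: (@sec_inj _ _ _ S (x * y * z)); rewrite -/k -/u.
transitivity (u x * u y * u z).
  by rewrite gmulfM -mulgA -sec_cocE mulgA -sec_cocE.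
rewrite -(mulgA x y z) gmulfM -[RHS]mulgA -sec_cocE mulgA -sec_actE.
by rewrite -!mulgA -sec_cocE.
Qed.

Lemma sec_act1 : sec_act 1 = monoid_id N.
Proof.
apply: monoid_hom_eq => n; apply: (@sec_inj _ _ _ S 1).
by rewrite /= -/k -/u -sec_actE /u sec1 mulg1 mul1g.
Qed.

Lemma sec_coc1l x : sec_coc 1 x = 1.
Proof.
apply: (@sec_inj _ _ _ S (1 * x)); rewrite /= -/k -/u -sec_cocE.
by rewrite /u sec1 gmulf1 !mul1g.
Qed.

Lemma sec_coc1r x : sec_coc x 1 = 1.
Proof.
apply: (@sec_inj _ _ _ S (x * 1)); rewrite /= -/k -/u -sec_cocE.
by rewrite /u sec1 gmulf1 !mulg1 mul1g.
Qed.

Lemma sec_fmap_proof x y : x = y ->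
  forall n, 1 * sec_act y n = sec_act x n * 1.
Proof. by move=> -> n; rewrite mul1g mulg1. Qed.

(** Given by the element 1 rather than by transport along [p], so that [sval] computes without
    destructing [p]. *)
Definition sec_fmap (x y : discrete H) (p : hom x y) :
    @hom (EndMonCo N) (sec_act x) (sec_act y) :=
  exist _ 1 (sec_fmap_proof p).

Lemma sec_fmap_id x : sec_fmap (idm x) = idm _.
Proof. exact: end_hom_eq. Qed.

Lemma sec_fmap_comp (x y z : discrete H) (q : hom y z) (p : hom x y) :
  sec_fmap (q ∘ p) = sec_fmap q ∘ sec_fmap p.
Proof. by apply: end_hom_eq; rewrite /= mulg1. Qed.

Definition sec_functor : functor (discrete H) (EndMonCo N) :=
  Functor sec_fmap_id sec_fmap_comp.

Lemma sec_unit_proof n : 1 * sec_act 1 n = monoid_id N n * 1.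
Proof. by rewrite sec_act1 mul1g mulg1. Qed.

(** Transparent, so that [lax_act] and [lax_coc] reduce to [sec_act] and [sec_coc] in the comparison
    with [E]. *)
Definition sec_lax : lax_monoidal_functor (discrete H) (EndMonCo N).
Proof.
apply: (@LaxMonoidalFunctor (discrete H) (EndMonCo N) sec_functor
  (exist _ 1 sec_unit_proof) (fun x y => exist _ (sec_coc x y) (sec_cocJ x y))).
- move=> x x' y y' p q; apply: end_hom_eq.
  case: x' / p; case: y' / q => /=.
  by rewrite sec_act_fun1 !mulg1 mul1g.
- move=> x y z; apply: end_hom_eq => /=.
  by rewrite sec_act_fun1 !mulg1 !mul1g sec_coc_assoc.
- by move=> x; apply: end_hom_eq; rewrite /= sec_act_fun1 sec_coc1l !mulg1.
- by move=> x; apply: end_hom_eq; rewrite /= sec_act_fun1 sec_coc1r !mulg1.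
Defined.

(** The unit map is 1 by construction; its codomain [sec_act 1] is the identity endomorphism only by
    [sec_act1], where normalization of the section enters. *)
Lemma sec_lax_normal : normal sec_lax.
Proof. by apply: end_is_identity => //=; rewrite sec_act1. Qed.

Definition sec_normal_lax :
    normal_lax_monoidal_functors (discrete H) (EndMonCo N) :=
  exist _ sec_lax sec_lax_normal.

Definition sec_iso_fun (a : crossed_product sec_normal_lax) : G :=
  k a.1 * u a.2.

Lemma sec_iso_fun1 : sec_iso_fun 1 = 1.
Proof. by rewrite /sec_iso_fun /= /u sec1 gmulf1 mulg1. Qed.

Lemma sec_iso_funM : {morph sec_iso_fun : a b / a * b}.
Proof.
move=> [n x] [m y]; rewrite /sec_iso_fun cp_mulE /= /lax_coc /=.
rewrite !gmulfM -!mulgA -sec_cocE; congr (_ * _).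
by rewrite !mulgA -sec_actE.
Qed.

Definition sec_iso_hom : monoid_hom (crossed_product sec_normal_lax) G :=
  make_monoid_hom sec_iso_fun1 sec_iso_funM.

Lemma sec_iso_k : monoid_comp sec_iso_hom (cp_k sec_normal_lax) = k.
Proof.
by apply: monoid_hom_eq => n; rewrite /= /sec_iso_fun /= /u sec1 mulg1.
Qed.

Lemma sec_iso_e : monoid_comp e sec_iso_hom = cp_e sec_normal_lax.
Proof.
apply: monoid_hom_eq => -[n x].
by rewrite /= /sec_iso_fun /= gmulfM ext_e_k sec_e mul1g.
Qed.

Definition sec_iso : extension_hom (cp_extension sec_normal_lax) E :=
  @ExtensionHom N H (cp_extension sec_normal_lax) E sec_iso_hom
    sec_iso_k sec_iso_e.

Lemma sec_iso_bij : bijective sec_iso.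
Proof.
exists (fun g => (d g, e g)) => [[n x] | g]; last exact/esym/sec_coordP.
rewrite /= /sec_iso_fun /= sec_coord_k.
by rewrite gmulfM ext_e_k sec_e mul1g.
Qed.

End ReconstructLax.

Theorem proposition4p2 (N H : monoidType) :
  equivalent_categories (schreier_extensions N H)
    (normal_lax_monoidal_functors (discrete H) (EndMonCo N)).
Proof.
(* The crossed product functor starts at the lax functors; the criterion yields the equivalence in
   the opposite order. *)
apply: (@fully_faithful_essentially_surjective_equivalence _ _ (cp_functor N H)).
- exact: cp_functor_faithful.
- exact: cp_functor_full.
- move=> [E schE]; have [S] := schreier_normal_section schE.
  exists (sec_normal_lax S), (sec_iso S).
  exact: extension_bijective_iso (sec_iso_bij S).
Qed.
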